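(* Let $\lambda\in\mathbb C^*$, $\alpha\in\mathbb C$, $\mathbf h\in\mathcal T_\alpha$, and let $V$ be a $Q$-module such that for every $v\in V$ one has $L_mv=0$ and $I_nv=0$ for all but finitely many $m\ge-1$ and $n\ge0$. Then the vector space $T(V,\Psi)=V\otimes\Psi(\lambda,\alpha,0,1,\mathbf h)$ is an $\mathcal H$-module under the action $$L_m(v\otimes f)=v\otimes L_mf+\Big((e^{mt}-1)\tfrac{d}{dt}\Big)v\otimes I_mf,\qquad I_m(v\otimes f)=e^{mt}v\otimes I_mf$$ for $m\in\mathbb Z$, $v\in V$, $f\in\mathbb C[t,s]$, where on $V$ the symbols denote the operators $e^{mt}=\sum_{i=0}^\infty\frac{m^i}{i!}I_i$ and $(e^{mt}-1)\frac{d}{dt}=\sum_{i=0}^\infty\frac{m^i}{i!}L_{i-1}-L_{-1}$.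
   Context: $\mathcal H$ is the centerless Heisenberg–Virasoro algebra: the complex Lie algebra with basis $\{L_m,I_m\mid m\in\mathbb Z\}$ and brackets $[L_m,L_n]=(n-m)L_{m+n}$, $[L_m,I_n]=nI_{m+n}$, $[I_m,I_n]=0$. $Q=\operatorname{span}\{L_m,I_n\mid m\ge-1,\,n\ge0\}$ is a subalgebra of $\mathcal H$. For $k\in\mathbb N=\{0,1,\dots\}$, $n\in\mathbb Z$, $\alpha\in\mathbb C$ put $h_{n,k;\alpha}(t)=nt^k-n(n-1)\alpha\frac{t^k-\alpha^k}{t-\alpha}\in\mathbb C[t]$. $\mathcal T_\alpha$ is the set of all families $\mathbf h=\{h_m(t)\mid m\in\mathbb Z\}$ of polynomials of the form $h_m(t)=\sum_{i\ge0}\xi_ih_{m,i;\alpha}(t)$ with $\xi_i\in\mathbb C$ independent of $m$ and all but finitely many zero. $\Psi(\lambda,\alpha,0,1,\mathbf h)$ is the $\mathcal H$-module $\mathbb C[t,s]$ with $L_mf(t,s)=-\lambda^m(s-h_m(-t))f(t,s+m)-m\lambda^m(t+m\alpha)\frac{\partial}{\partial t}f(t,s+m)$ and $I_mf(t,s)=\lambda^mf(t,s+m)$. The symbol $t$ in $e^{mt}$ and $\frac{d}{dt}$ is purely formal notation for the operators on $V$ given in the claim and is unrelated to the variable $t$ of $\mathbb C[t,s]$. The convention $m^0=1$ is used also for $m=0$. *)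

(* Defs.v *)
From HB Require Import structures.
From mathcomp Require Import all_boot all_order all_algebra.
From mathcomp Require Import generic_quotient ring_quotient.
From mathcomp Require Import boolp classical_sets cardinality fsbigop.
From mathcomp Require Import ring zify freeg mpoly.

Set Implicit Arguments.
Unset Strict Implicit.
Unset Printing Implicit Defensive.

Import Order.TTheory GRing.Theory Num.Theory.

Local Open Scope ring_scope.

Section LinearSpan.
Variables (F : fieldType) (V : lmodType F).

Definition lin_span (A : set V) : pred V := fun x =>
  `[< forall S : {pred V}, GRing.submod_closed S ->
      (forall a, A a -> a \in S) -> x \in S >].

Lemma lin_spanP (A : set V) x :
  reflect (forall S : {pred V}, GRing.submod_closed S ->
             (forall a, A a -> a \in S) -> x \in S)
          (x \in lin_span A).
Proof. exact: asboolP. Qed.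

Lemma mem_lin_span (A : set V) x : A x -> x \in lin_span A.
Proof. by move=> Ax; apply/lin_spanP => S _; apply. Qed.

Lemma lin_span_submod_closed (A : set V) : GRing.submod_closed (lin_span A).
Proof.
split=> [|a x y /lin_spanP hx /lin_spanP hy]; apply/lin_spanP => S hS AS.
  exact: hS.1.
by apply: hS.2; [apply: hx | apply: hy].
Qed.

HB.instance Definition _ (A : set V) :=
  GRing.isSubmodClosed.Build F V (lin_span A) (lin_span_submod_closed A).

Lemma lin_span_ind (A : set V) (P : V -> Prop) :
  P 0 -> (forall a x y, P x -> P y -> P (a *: x + y)) ->
  (forall x, A x -> P x) -> forall x, x \in lin_span A -> P x.
Proof.
move=> P0 PD PA x /lin_spanP/(_ (fun z => `[< P z >])) hx.
apply/asboolP/hx => [|a /PA Pa]; last exact/asboolP.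
by split=> [|a u v /asboolP Pu /asboolP Pv]; apply/asboolP => //; apply: PD.
Qed.

End LinearSpan.

Section FreeModule.
Variables (F : fieldType) (K : choiceType) (W : lmodType F).

Lemma freegUZ (c : F) (k : K) : << c *g k >> = c *: << k >>.
Proof. by apply/eqP/freeg_eqP => x; rewrite coeffZ !coeffU mul1r. Qed.

Lemma fglift_linear (f : K -> W) : linear (fglift f).
Proof.
have D u v : fglift f (u + v) = fglift f u + fglift f v.
  have f0 : fglift f 0 = 0 by rewrite -(subrr 0) lift_is_additive subrr.
  have N : fglift f (- v) = - fglift f v.
    by rewrite -[- v]sub0r lift_is_additive f0 sub0r.
  by rewrite -[in LHS](opprK v) lift_is_additive N opprK.
have f0 : fglift f 0 = 0 by rewrite -(subrr 0) lift_is_additive subrr.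
move=> a u v; rewrite D; congr (_ + _).
elim/freeg_ind_dom0: u => [|k x u _ _ IH]; first by rewrite scaler0 f0 scaler0.
by rewrite scalerDr !D scalerDr IH [<< k *g x >>]freegUZ scalerA -!freegUZ
  !liftU scalerA.
Qed.

HB.instance Definition _ (f : K -> W) :=
  GRing.isLinear.Build F {freeg K / F} W _ (fglift f) (fglift_linear f).

Lemma fglift1 (f : K -> W) k : fglift f << k >> = f k.
Proof. by rewrite liftU scale1r. Qed.

Lemma freeg_linear_eq (f g : {linear {freeg K / F} -> W}) :
  (forall k, f << k >> = g << k >>) -> f =1 g.
Proof.
move=> fg u; elim/freeg_ind_dom0: u => [|k x u _ _ IH]; first by rewrite !linear0.
by rewrite freegUZ !linearP fg IH.
Qed.

End FreeModule.

Section TensorProduct.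
Variables (F : fieldType) (V W : lmodType F).

Definition bilinear_relator : set {freeg (V * W)%type / F} := fun r =>
  (exists a v v' w, r = << (a *: v + v', w) >> - (a *: << (v, w) >> + << (v', w) >>))
  \/ (exists a v w w',
        r = << (v, a *: w + w') >> - (a *: << (v, w) >> + << (v, w') >>)).

Definition tensor_kernel : {freeg (V * W)%type / F} -> bool :=
  lin_span bilinear_relator.

HB.instance Definition _ := GRing.isSubmodClosed.Build F _ tensor_kernel
  (lin_span_submod_closed bilinear_relator).

Definition tensor := Quotient.quot (GRing.ZmodClosed.clone _ tensor_kernel _).

HB.instance Definition _ := GRing.Zmodule.on tensor.

Definition tensor_pi (u : {freeg (V * W)%type / F}) : tensor :=
  \pi_tensor%qT u.

Lemma tensor_piD u v : tensor_pi (u + v) = tensor_pi u + tensor_pi v.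
Proof. exact: (raddfD (\pi_tensor%qT)). Qed.

Lemma tensor_pi_eq u v : (tensor_pi u == tensor_pi v) = (u - v \in tensor_kernel).
Proof. by rewrite Quotient.idealrBE. Qed.

Lemma tensor_piK (x : tensor) : tensor_pi (repr x) = x.
Proof. exact: reprK. Qed.

Definition tensor_scale (a : F) (x : tensor) : tensor :=
  tensor_pi (a *: repr x).

Lemma tensor_scale_pi a u : tensor_scale a (tensor_pi u) = tensor_pi (a *: u).
Proof.
apply/eqP; rewrite tensor_pi_eq -scalerBr rpredZ // -tensor_pi_eq.
by rewrite tensor_piK.
Qed.

Fact tensor_scaleA a b x :
  tensor_scale a (tensor_scale b x) = tensor_scale (a * b) x.
Proof. by rewrite -[x]tensor_piK !tensor_scale_pi scalerA. Qed.

Fact tensor_scale1 : left_id 1 tensor_scale.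
Proof. by move=> x; rewrite -[x]tensor_piK tensor_scale_pi scale1r. Qed.

Fact tensor_scaleDr : right_distributive tensor_scale +%R.
Proof.
move=> a x y; rewrite -[x]tensor_piK -[y]tensor_piK -tensor_piD.
by rewrite !tensor_scale_pi scalerDr tensor_piD.
Qed.

Fact tensor_scaleDl x : {morph tensor_scale^~ x : a b / a + b}.
Proof.
by move=> a b; rewrite -[x]tensor_piK !tensor_scale_pi scalerDl tensor_piD.
Qed.

HB.instance Definition _ := GRing.Zmodule_isLmodule.Build F tensor
  tensor_scaleA tensor_scale1 tensor_scaleDr tensor_scaleDl.

Lemma tensor_pi_linear : linear tensor_pi.
Proof. by move=> a u v; rewrite tensor_piD -tensor_scale_pi. Qed.

HB.instance Definition _ :=
  GRing.isLinear.Build F _ tensor _ tensor_pi tensor_pi_linear.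

Definition tens (v : V) (w : W) : tensor := tensor_pi << (v, w) >>.

Lemma tens_linearl w : linear (tens^~ w).
Proof.
move=> a v v'; rewrite /tens -linearP; apply/eqP; rewrite tensor_pi_eq.
by apply: mem_lin_span; left; exists a, v, v', w.
Qed.

Lemma tens_linearr v : linear (tens v).
Proof.
move=> a w w'; rewrite /tens -linearP; apply/eqP; rewrite tensor_pi_eq.
by apply: mem_lin_span; right; exists a, v, w, w'.
Qed.

Lemma tensZl a v w : tens (a *: v) w = a *: tens v w.
Proof.
have t0 : tens 0 w = 0.
  by have := tens_linearl w (-1) 0 0; rewrite scaler0 addr0 scaleN1r addNr.
by have := tens_linearl w a v 0; rewrite addr0 t0 addr0.
Qed.

Lemma tensor_ind (P : tensor -> Prop) :
  P 0 -> (forall v w x, P x -> P (tens v w + x)) -> forall x, P x.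
Proof.
move=> P0 PD x; rewrite -[x]tensor_piK.
elim/freeg_ind_dom0: (repr x) => [|k [v w] u _ _ IH]; first by rewrite linear0.
by rewrite freegUZ linearP; have := PD (k *: v) w _ IH; rewrite tensZl.
Qed.

Lemma tensor_lift (U : lmodType F) (b : V -> W -> U) :
  (forall w, linear (b^~ w)) -> (forall v, linear (b v)) ->
  exists f : {linear tensor -> U}, forall v w, f (tens v w) = b v w.
Proof.
move=> bl br; pose g : {linear _ -> U} := fglift (fun p : V * W => b p.1 p.2).
have gl : linear g by exact: fglift_linear.
have gK u : u \in tensor_kernel -> g u = 0.
  elim/lin_span_ind => [|a x y x0 y0|r]; first exact: linear0.
    by rewrite gl x0 y0 scaler0 addr0.
  case=> [[a [v [v' [w ->]]]]|[a [v [w [w' ->]]]]].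
    by rewrite linearB gl /g /= !fglift1 /= bl subrr.
  by rewrite linearB gl /g /= !fglift1 /= br subrr.
have gE u : g (repr (tensor_pi u)) = g u.
  apply/eqP; rewrite -subr_eq0 -linearB; apply/eqP/gK.
  by rewrite -tensor_pi_eq tensor_piK.
pose f (x : tensor) := g (repr x).
have f_lin : linear f.
  move=> a x y; rewrite /f -[x in LHS]tensor_piK -[y in LHS]tensor_piK -linearP.
  by rewrite gE gl.
pose fm := GRing.isLinear.Build F tensor U _ f f_lin.
pose fl : {linear tensor -> U} := HB.pack f fm.
exists fl => v w.
by rewrite /= /f gE /g /= fglift1.
Qed.

End TensorProduct.

HB.mixin Record Lmodule_isLieAlgebra (F : fieldType) g of GRing.Lmodule F g := {
  lie : g -> g -> g;
  lie_linearl : forall y, linear (lie^~ y);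
  lie_linearr : forall x, linear (lie x);
  liexx : forall x, lie x x = 0;
  lie_jacobi : forall x y z,
    lie x (lie y z) + lie y (lie z x) + lie z (lie x y) = 0
}.

#[short(type="lieAlgType")]
HB.structure Definition LieAlgebra (F : fieldType) :=
  { g of Lmodule_isLieAlgebra F g & GRing.Lmodule F g }.

Record lie_module (F : fieldType) (g : lieAlgType F) (V : lmodType F) := LieModule {
  lie_act :> g -> V -> V;
  lie_act_linearl : forall v, linear (lie_act^~ v);
  lie_act_linearr : forall x, linear (lie_act x);
  lie_act_lie : forall x y v,
    lie_act (lie x y) v = lie_act x (lie_act y v) - lie_act y (lie_act x v)
}.

Section HeisenbergVirasoro.
Variable F : fieldType.

(* inl m indexes the basis vector L_m, and inr m the basis vector I_m. *)
Definition HV := {freeg (int + int)%type / F}.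
HB.instance Definition _ := GRing.Lmodule.on HV.

Definition HVL (m : int) : HV := << inl m >>.
Definition HVI (m : int) : HV := << inr m >>.

Definition HV_basis_lie (a b : int + int) : HV :=
  match a, b with
  | inl m, inl n => (n - m)%:~R *: HVL (m + n)
  | inl m, inr n => n%:~R *: HVI (m + n)
  | inr m, inl n => - (m%:~R *: HVI (n + m))
  | inr _, inr _ => 0
  end.

Definition HV_lie (x y : HV) : HV :=
  fglift (fun a => fglift (HV_basis_lie a) y) x.

Fact HV_lie_linearl y : linear (HV_lie^~ y).
Proof. exact: fglift_linear. Qed.

Lemma HV_lie_basisl a y : HV_lie << a >> y = fglift (HV_basis_lie a) y.
Proof. exact: fglift1. Qed.

Lemma HV_lie_basis a b : HV_lie << a >> << b >> = HV_basis_lie a b.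
Proof. by rewrite HV_lie_basisl fglift1. Qed.

Lemma freeg_span_ind (K : choiceType) (P : {freeg K / F} -> Prop) :
  P 0 -> (forall c k u, P u -> P (c *: << k >> + u)) -> forall u, P u.
Proof.
move=> P0 PD; elim/freeg_ind_dom0 => // c k u _ _ Pu.
by rewrite freegUZ; apply: PD.
Qed.

Fact HV_lie_linearr x : linear (HV_lie x).
Proof.
move=> a y z; elim/freeg_span_ind: x => [|c k u IH].
  by rewrite /HV_lie !linear0 addr0.
rewrite !(HV_lie_linearl _ c << k >> u) IH !HV_lie_basisl linearP.
by rewrite !scalerDr !scalerA [a * c]mulrC addrACA.
Qed.

Lemma HV_lie0l y : HV_lie 0 y = 0.
Proof. exact: linear0. Qed.

Lemma HV_lie0r x : HV_lie x 0 = 0.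
Proof.
by have := HV_lie_linearr x (-1) 0 0; rewrite scaler0 addr0 scaleN1r addNr.
Qed.

Fact HV_lie_antisym x y : HV_lie x y = - HV_lie y x.
Proof.
elim/freeg_span_ind: x => [|c a u IH]; first by rewrite HV_lie0l HV_lie0r oppr0.
rewrite HV_lie_linearl HV_lie_linearr {}IH opprD -scalerN; congr (_ *: _ + _).
elim/freeg_span_ind: y {u} => [|d b u IH]; first by rewrite HV_lie0l HV_lie0r oppr0.
rewrite HV_lie_linearl HV_lie_linearr {}IH opprD -scalerN; congr (_ *: _ + _).
rewrite !HV_lie_basis; case: a b => [m|m] [n|n] /=; rewrite ?opprK ?oppr0 //.
by rewrite -scaleNr -mulrNz opprB addrC [m + n]addrC.
Qed.

Fact HV_liexx x : HV_lie x x = 0.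
Proof.
elim/freeg_span_ind: x => [|c a u IH]; first exact: HV_lie0l.
rewrite HV_lie_linearl !HV_lie_linearr IH addr0 [HV_lie u _]HV_lie_antisym.
rewrite HV_lie_basis scalerDr scalerN addrK.
by case: a => m /=; rewrite ?subrr ?scale0r !scaler0.
Qed.

Fact HV_lie_jacobi x y z :
  HV_lie x (HV_lie y z) + HV_lie y (HV_lie z x) + HV_lie z (HV_lie x y) = 0.
Proof.
pose J x y z := HV_lie x (HV_lie y z) + HV_lie y (HV_lie z x) + HV_lie z (HV_lie x y).
rewrite -/(J x y z).
have JC u v w : J u v w = J v w u by rewrite /J -addrA addrC.
have J0 v w : J 0 v w = 0 by rewrite /J !(HV_lie0l, HV_lie0r) !addr0.
have JP c u u' v w : J (c *: u + u') v w = c *: J u v w + J u' v w.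
  rewrite /J !(HV_lie_linearl, HV_lie_linearr) !scalerDr.
  by rewrite (addrACA (c *: _)) (addrACA (_ + _)).
suff JB a b f : J << a >> << b >> << f >> = 0.
  move: (J) JC J0 JP JB => {}J JC J0 JP JB.
  elim/freeg_span_ind: x => [|c a u IH]; first exact: J0.
  rewrite JP {}IH addr0 JC.
  elim/freeg_span_ind: y {u} => [|d b u IH]; first by rewrite J0 scaler0.
  rewrite JP scalerDr {}IH addr0 JC.
  elim/freeg_span_ind: z {u} => [|e f u IH]; first by rewrite J0 !scaler0.
  rewrite JP !scalerDr {}IH addr0 JC.
  by rewrite JB !scaler0.
have lieZr w k v : HV_lie w (k *: v) = k *: HV_lie w v.
  by have := HV_lie_linearr w k v 0; rewrite HV_lie0r !addr0.
have lieNr w v : HV_lie w (- v) = - HV_lie w v.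
  by rewrite -scaleN1r lieZr scaleN1r.
have key (G : int -> HV) (i j k p q r : int) : j = i -> k = i -> p + q + r = 0 ->
    p%:~R *: G i + q%:~R *: G j + r%:~R *: G k = 0.
  by move=> -> ->; rewrite -!scalerDl -!intrD => ->; rewrite scale0r.
rewrite /J !HV_lie_basis.
case: a b f => [m|m] [n|n] [p|p] /=;
  rewrite /HVL /HVI ?(lieNr, lieZr, HV_lie0r, HV_lie_basis) /= ?scaler0 ?oppr0 ?addr0 ?add0r //;
  rewrite ?scalerN -?scaleNr ?scalerA -?mulrNz -?intrM;
  first (apply: (key HVL); ring); apply: (key HVI); ring.
Qed.

HB.instance Definition _ := Lmodule_isLieAlgebra.Build F HV
  HV_lie_linearl HV_lie_linearr HV_liexx HV_lie_jacobi.
Lemma lie_HVL m n : lie (HVL m) (HVL n) = (n - m)%:~R *: HVL (m + n).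
Proof. exact: HV_lie_basis. Qed.

Lemma lie_HVLI m n : lie (HVL m) (HVI n) = n%:~R *: HVI (m + n).
Proof. exact: HV_lie_basis. Qed.

Lemma lie_HVI m n : lie (HVI m) (HVI n) = 0.
Proof. exact: HV_lie_basis. Qed.

Definition HVQ_gen : set HV := fun x =>
  (exists2 m : int, -1 <= m & x = HVL m) \/ (exists2 n : int, 0 <= n & x = HVI n).

Definition HVQ_pred : HV -> bool := lin_span HVQ_gen.

HB.instance Definition _ := GRing.isSubmodClosed.Build F HV HVQ_pred
  (lin_span_submod_closed HVQ_gen).

Lemma HVL_in_Q m : -1 <= m -> HVL m \in HVQ_pred.
Proof. by move=> m_ge; apply: mem_lin_span; left; exists m. Qed.

Lemma HVI_in_Q n : 0 <= n -> HVI n \in HVQ_pred.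
Proof. by move=> n_ge; apply: mem_lin_span; right; exists n. Qed.

Lemma HVQ_lie_closed x y :
  x \in HVQ_pred -> y \in HVQ_pred -> lie x y \in HVQ_pred.
Proof.
move=> xQ yQ; move: x xQ; apply: lin_span_ind => [|c x x' Qx Qx'|x Ax].
- by rewrite [lie _ _]HV_lie0l rpred0.
- by rewrite lie_linearl rpredD // rpredZ.
move: y yQ; apply: lin_span_ind => [|c y y' Qy Qy'|y Ay].
- by rewrite [lie _ _]HV_lie0r rpred0.
- by rewrite lie_linearr rpredD // rpredZ.
case: Ax Ay => [[m m_ge ->]|[m m_ge ->]] [[n n_ge ->]|[n n_ge ->]].
- rewrite lie_HVL; have [mn_ge|mn_lt] := lerP (-1) (m + n).
    by rewrite rpredZ // HVL_in_Q.
  by have -> : n - m = 0 :> int; [lia | rewrite mulr0z scale0r rpred0].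
- rewrite lie_HVLI; have [mn_ge|mn_lt] := lerP 0 (m + n).
    by rewrite rpredZ // HVI_in_Q.
  by have -> : n = 0 :> int; [lia | rewrite mulr0z scale0r rpred0].
- rewrite [lie _ _]HV_lie_antisym [HV_lie _ _]lie_HVLI rpredN.
  have [mn_ge|mn_lt] := lerP 0 (n + m); first by rewrite rpredZ // HVI_in_Q.
  by have -> : m = 0 :> int; [lia | rewrite mulr0z scale0r rpred0].
- by rewrite lie_HVI rpred0.
Qed.

Record HVQ := MkHVQ { HVQ_val : HV; _ : HVQ_val \in HVQ_pred }.
HB.instance Definition _ := [isSub for HVQ_val].
HB.instance Definition _ := [Choice of HVQ by <:].
HB.instance Definition _ := [SubChoice_isSubLmodule of HVQ by <:].

Definition HVQ_lie (x y : HVQ) : HVQ :=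
  MkHVQ (HVQ_lie_closed (valP x) (valP y)).

Fact HVQ_lie_linearl y : linear (HVQ_lie^~ y).
Proof. by move=> a x x'; apply: val_inj; rewrite /= lie_linearl. Qed.

Fact HVQ_lie_linearr x : linear (HVQ_lie x).
Proof. by move=> a y y'; apply: val_inj; rewrite /= lie_linearr. Qed.

Fact HVQ_liexx x : HVQ_lie x x = 0.
Proof. by apply: val_inj; rewrite /= liexx. Qed.

Fact HVQ_lie_jacobi x y z :
  HVQ_lie x (HVQ_lie y z) + HVQ_lie y (HVQ_lie z x) + HVQ_lie z (HVQ_lie x y) = 0.
Proof. by apply: val_inj; rewrite /= lie_jacobi. Qed.

HB.instance Definition _ := Lmodule_isLieAlgebra.Build F HVQ
  HVQ_lie_linearl HVQ_lie_linearr HVQ_liexx HVQ_lie_jacobi.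

(* L_m and I_n as elements of Q; junk value 0 when m < -1, resp. n < 0. *)
Definition HVQL (m : int) : HVQ := insubd 0 (HVL m).
Definition HVQI (n : int) : HVQ := insubd 0 (HVI n).

Lemma val_HVQL m : -1 <= m -> val (HVQL m) = HVL m.
Proof. by move=> m_ge; rewrite insubdK ?HVL_in_Q. Qed.

Lemma val_HVQI n : 0 <= n -> val (HVQI n) = HVI n.
Proof. by move=> n_ge; rewrite insubdK ?HVI_in_Q. Qed.

End HeisenbergVirasoro.

Section Psi.
Variable F : fieldType.
Implicit Types (lambda alpha : F) (h : int -> {poly F}) (f : {mpoly F[2]}).

Definition hpoly (n : int) (k : nat) alpha : {poly F} :=
  n%:~R *: 'X^k
  - (n%:~R * (n - 1)%:~R * alpha) *: (('X^k - (alpha ^+ k)%:P) %/ ('X - alpha%:P)).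

Definition T_family alpha : set (int -> {poly F}) := fun h =>
  exists2 xi : nat -> F, finite_set [set i | xi i != 0]%classic &
    forall m, h m = \sum_(i \in [set: nat]%classic) xi i *: hpoly m i alpha.

Definition tvar : {mpoly F[2]} := 'X_ord0.
Definition svar : {mpoly F[2]} := 'X_ord_max.

(* f(t, s + m) *)
Definition s_shift (m : int) f : {mpoly F[2]} :=
  f \mPo [tuple tvar; svar + m%:~R].

Definition PsiL lambda alpha h (m : int) f : {mpoly F[2]} :=
  - (lambda ^ m *: ((svar - (map_poly (@mpolyC 2 F) (h m)).[- tvar]) * s_shift m f))
  - (m%:~R * lambda ^ m) *:
      ((tvar + (m%:~R * alpha)%:MP) * s_shift m (f^`M(ord0))).

Definition PsiI lambda (m : int) f : {mpoly F[2]} := lambda ^ m *: s_shift m f.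

End Psi.

Section ExponentialOperators.
Variables (F : fieldType) (V : lmodType F) (rho : lie_module (HVQ F) V).

(* \sum_(i \in A) sums over the support of the summand if that is finite;
   it is 0 otherwise. *)
Definition op_exp (m : int) (v : V) : V :=
  \sum_(i \in [set: nat]%classic) (m%:~R ^+ i / i`!%:R) *: rho (HVQI F i%:Z) v.

Definition op_expD (m : int) (v : V) : V :=
  \sum_(i \in [set: nat]%classic)
      (m%:~R ^+ i / i`!%:R) *: rho (HVQL F (i%:Z - 1)) v
  - rho (HVQL F (-1)) v.

Definition locally_finite : Prop :=
  forall v,
    finite_set [set m : int | -1 <= m /\ rho (HVQL F m) v <> 0]%classic /\
    finite_set [set n : int | 0 <= n /\ rho (HVQI F n) v <> 0]%classic.

End ExponentialOperators.

(* Main.v *)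
(**
  On [V] put [E_m = sum_i m^i/i! L_(i-1)] and [e_m = sum_i m^i/i! I_i]. Comparing
  exponential generating functions, the brackets of [Q] give
  [[E_m, E_n] = (n - m) E_(m+n)], [[E_m, e_n] = n e_(m+n)] and [[e_m, e_n] = 0].
  Hence [D_m = E_m - E_0] satisfies
  [[D_m, D_n] = (n - m) D_(m+n) + m D_m - n D_n] and
  [[D_m, e_n] = n (e_(m+n) - e_n)], and on the tensor product the extra terms
  cancel against those coming from [[L_m, I_n] = n I_(m+n)] and
  [I_m I_n = I_(m+n)] on [Psi]. That [Psi] is itself a module amounts to a
  cocycle identity for the family [h], which is checked on each [h_(n,k;alpha)].
*)
Require Import Defs.
From HB Require Import structures.
From mathcomp Require Import all_boot all_order all_algebra.
From mathcomp Require Import complex reals mpoly.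
From mathcomp Require Import boolp classical_sets cardinality fsbigop freeg.
From mathcomp Require Import ring zify.

Import GRing.Theory.
Local Open Scope ring_scope.

Set Implicit Arguments.
Unset Strict Implicit.
Unset Printing Implicit Defensive.

Lemma linear_fun0 (F : fieldType) (V W : lmodType F) (f : V -> W) :
  linear f -> f 0 = 0.
Proof.
by move=> flin; have := flin (-1) 0 0; rewrite scaler0 addr0 scaleN1r addNr.
Qed.

Section ExpSum.
Context (F : fieldType) (V : lmodType F).
Hypothesis F0 : [pchar F] =i pred0.
Implicit Types (X : nat -> V) (x y : F).

Definition expsum M x X : V := \sum_(0 <= i < M) (x ^+ i / i`!%:R) *: X i.

Lemma eq_expsum M x X Y : X =1 Y -> expsum M x X = expsum M x Y.
Proof. by move=> XY; apply: eq_bigr => i _; rewrite XY. Qed.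

Lemma expsumZ M x X a : expsum M x (fun i => a *: X i) = a *: expsum M x X.
Proof.
by rewrite scaler_sumr; apply: eq_bigr => i _; rewrite !scalerA mulrC.
Qed.

Lemma expsumB M x X Y :
  expsum M x (fun i => X i - Y i) = expsum M x X - expsum M x Y.
Proof. by rewrite -sumrB; apply: eq_bigr => i _; rewrite scalerBr. Qed.

Lemma expsum_exchange M N x y (X : nat -> nat -> V) :
  expsum M x (fun i => expsum N y (X i)) =
  expsum N y (fun j => expsum M x (X^~ j)).
Proof.
under eq_expsum => i do rewrite /expsum.
rewrite /expsum; under eq_bigr do rewrite scaler_sumr.
rewrite exchange_big /=; apply: eq_bigr => j _; rewrite scaler_sumr.
by apply: eq_bigr => i _; rewrite !scalerA mulrC.
Qed.

Lemma expsum_widen K M x X :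
  (forall i, (K <= i)%N -> X i = 0) -> (K <= M)%N ->
  expsum M x X = expsum K x X.
Proof.
move=> X0 KM; rewrite /expsum (big_cat_nat (leq0n K) KM) /=.
rewrite [Y in _ + Y]big_nat_cond [Y in _ + Y]big1 ?addr0 //.
by move=> i /andP[] /andP[Ki _] _; rewrite X0 ?scaler0.
Qed.

Lemma fact_neq0 i : i`!%:R != 0 :> F.
Proof. by rewrite (pcharf0P F).1 // -lt0n fact_gt0. Qed.

Lemma expsum_shift M x X :
  expsum M.+1 x (fun j => j%:R *: X j.-1) = x *: expsum M x X.
Proof.
rewrite /expsum big_nat_recl //= scale0r scaler0 add0r scaler_sumr.
apply: eq_bigr => i _; rewrite !scalerA; congr (_ *: _).
have i0 := fact_neq0 i; have := fact_neq0 i.+1; rewrite factS natrM.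
rewrite mulf_eq0 negb_or => /andP[i1 _]; rewrite exprS.
by field; rewrite i0 addrC natr1 i1.
Qed.

Lemma expsumD K M N x y X :
  (forall k, (K <= k)%N -> X k = 0) -> (K <= M)%N -> (K <= N)%N ->
  expsum M x (fun i => expsum N y (fun j => X (i + j)%N)) = expsum K (x + y) X.
Proof.
move=> X0 KM KN.
rewrite (@expsum_widen K) //; last first.
  move=> i Ki; rewrite /expsum big1 // => j _.
  by rewrite X0 ?scaler0 // (leq_trans Ki) ?leq_addr.
have E i : (i < K)%N ->
    (x ^+ i / i`!%:R) *: expsum N y (fun j => X (i + j)%N) =
    \sum_(0 <= k < K | (i <= k)%N)
       (x ^+ i / i`!%:R * (y ^+ (k - i) / (k - i)`!%:R)) *: X k.
  move=> iK; rewrite (@expsum_widen (K - i)) ?(leq_trans (leq_subr _ _)) //; last first.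
    by move=> j; rewrite leq_subLR => /X0.
  rewrite /expsum scaler_sumr.
  under eq_bigr do rewrite scalerA.
  rewrite [RHS]big_mkcond /= (big_cat_nat (leq0n i) (ltnW iK)) /=.
  rewrite [Y in Y + _]big_nat_cond [Y in Y + _]big1 ?add0r; last first.
    by move=> k /andP[/andP[_ ki] _]; rewrite leqNgt ki.
  have -> (G : nat -> V) : \sum_(i <= k < K) G k = \sum_(0 <= j < K - i) G (j + i)%N.
    by have := @big_addn _ 0 +%R 0 K i xpredT G; rewrite add0n.
  apply: eq_bigr => j _.
  by rewrite leq_addl addnK [(j + i)%N]addnC.
rewrite [LHS]/expsum big_nat_cond.
under eq_bigr => i /andP[/andP[_ iK] _] do rewrite E //.
rewrite -big_nat_cond (exchange_big_dep_nat xpredT) //=.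
rewrite /expsum !big_nat; apply: eq_bigr => k /andP[_ kK].
rewrite -scaler_suml; congr (_ *: _).
transitivity (\sum_(0 <= i < k.+1) x ^+ i / i`!%:R * (y ^+ (k - i) / (k - i)`!%:R)).
  by rewrite (@big_nat_widen _ _ _ 0 k.+1 K).
rewrite big_mkord addrC exprDn mulr_suml; apply: eq_bigr => i _.
have ik : (i <= k)%N by rewrite -ltnS.
have kE : k`!%:R = 'C(k, i)%:R * i`!%:R * (k - i)`!%:R :> F.
  by rewrite -!natrM -mulnA bin_fact.
have Cki : 'C(k, i)%:R != 0 :> F by rewrite (pcharf0P F).1 // -lt0n bin_gt0.
have i0 := fact_neq0 i; have ki0 := fact_neq0 (k - i).
by rewrite kE -mulr_natr; field; rewrite Cki i0 ki0.
Qed.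

Definition locally_finite_family (a : nat -> V -> V) : Prop :=
  forall v, exists N, forall i, (N <= i)%N -> a i v = 0.

Definition exp_op (a : nat -> V -> V) x v : V :=
  \sum_(i \in [set: nat]%classic) (x ^+ i / i`!%:R) *: a i v.

Lemma exp_opE a N x v :
  (forall i, (N <= i)%N -> a i v = 0) -> exp_op a x v = expsum N x (a^~ v).
Proof.
move=> a0; rewrite /expsum big_mkord.
rewrite [RHS](fsbig_ord _ _ (fun i => (x ^+ i / i`!%:R) *: a i v)).
apply/esym/fsbig_widen => // i [_ /=] /negP; rewrite -leqNgt => Ni.
by rewrite a0 ?scaler0.
Qed.

Lemma exp_op0 a v : locally_finite_family a -> exp_op a 0 v = a 0%N v.
Proof.
move=> /(_ v)[N a0]; rewrite (@exp_opE _ N.+1); last by move=> i /ltnW/a0.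
rewrite /expsum big_nat_recl // expr0 fact0 divr1 scale1r big1 ?addr0 // => i _.
by rewrite expr0n mul0r scale0r.
Qed.

Lemma exp_op_linear a x : locally_finite_family a ->
  (forall i, linear (a i)) -> linear (exp_op a x).
Proof.
move=> afin alin c u v; have [N u0] := afin u; have [M v0] := afin v.
have uv0 i : (maxn N M <= i)%N -> [/\ a i u = 0, a i v = 0 & a i (c *: u + v) = 0].
  rewrite geq_max => /andP[/u0 uE /v0 vE].
  by split=> //; rewrite alin uE vE scaler0 addr0.
rewrite !(@exp_opE _ (maxn N M)); try by move=> i /uv0[].
rewrite -expsumZ /expsum -big_split; apply: eq_bigr => i _ /=.
by rewrite alin scalerDr.
Qed.

Lemma linear_expsum (f : V -> V) N x X :
  linear f -> f (expsum N x X) = expsum N x (f \o X).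
Proof.
move=> flin; elim: N => [|N IH]; rewrite /expsum.
  by rewrite !big_geq ?linear_fun0.
by rewrite !big_nat_recr //= addrC flin addrC -/(expsum _ _ _) IH.
Qed.

Lemma comp_eventually0 a N (X : nat -> V) :
  locally_finite_family a -> (forall i, linear (a i)) ->
  (forall j, (N <= j)%N -> X j = 0) ->
  exists K, forall i j, (K <= i)%N -> a i (X j) = 0.
Proof.
move=> afin alin X0.
suff [K aK] : exists K, forall i j, (K <= i)%N -> (j < N)%N -> a i (X j) = 0.
  exists K => i j Ki; have [/X0->|/(aK _ _ Ki)//] := leqP N j.
  exact: linear_fun0.
elim: N {X0} => [|N [K aK]]; first by exists 0%N.
have [M aM] := afin (X N); exists (maxn K M) => i j; rewrite geq_max ltnS.
by case/andP=> Ki Mi; rewrite leq_eqVlt => /orP[/eqP->|]; [exact: aM | exact: aK].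
Qed.

Lemma exp_op_comp a b x y v N K :
  (forall i, linear (a i)) ->
  (forall j, (N <= j)%N -> b j v = 0) ->
  (forall i j, (K <= i)%N -> a i (b j v) = 0) ->
  exp_op a x (exp_op b y v) = expsum K x (fun i => expsum N y (fun j => a i (b j v))).
Proof.
move=> alin b0 ab0.
have E i : a i (exp_op b y v) = expsum N y (fun j => a i (b j v)).
  by rewrite (exp_opE _ b0) linear_expsum.
rewrite (@exp_opE _ K) => [|i Ki]; first exact: eq_expsum.
by rewrite E /expsum big1 // => j _; rewrite ab0 ?scaler0.
Qed.

(* Both sides have the double exponential generating function of [u j - w i];
   the factor [j] (resp. [i]) turns into multiplication by [y] (resp. [x]). *)
Lemma exp_op_comm a b c u w x y v :
  locally_finite_family a -> locally_finite_family b -> locally_finite_family c ->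
  (forall i, linear (a i)) -> (forall i, linear (b i)) ->
  (forall i j v, a i (b j v) - b j (a i v) =
     (u * j%:R - w * i%:R) *: c (i + j).-1 v) ->
  exp_op a x (exp_op b y v) - exp_op b y (exp_op a x v) =
  (u * y - w * x) *: exp_op c (x + y) v.
Proof.
move=> afin bfin cfin alin blin abc.
have [Na a0] := afin v; have [Nb b0] := bfin v; have [Nc c0] := cfin v.
have [Kab ab0] := comp_eventually0 afin alin b0.
have [Kba ba0] := comp_eventually0 bfin blin a0.
pose M := maxn (maxn Na Nb) (maxn Nc (maxn Kab Kba)).
have [MNa MNb MNc MKab MKba] :
    [/\ (Na <= M)%N, (Nb <= M)%N, (Nc <= M)%N, (Kab <= M)%N & (Kba <= M)%N].
  by rewrite /M; split; lia.
rewrite (@exp_op_comp a b x y v M.+1 M.+1) //; first last.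
- by move=> i j Mi; apply: ab0; lia.
- by move=> j Mj; apply: b0; lia.
rewrite (@exp_op_comp b a y x v M.+1 M.+1) //; first last.
- by move=> i j Mi; apply: ba0; lia.
- by move=> j Mj; apply: a0; lia.
rewrite [X in _ - X]expsum_exchange -expsumB.
pose C k := c k v.
have C0 k : (M <= k)%N -> C k = 0 by move=> Mk; apply: c0; lia.
have step1 : expsum M.+1 x (fun i => expsum M.+1 y (fun j => j%:R *: C (i + j).-1)) =
   y *: exp_op c (x + y) v.
  rewrite (exp_opE _ c0) -(@expsum_widen Nc M) // -(@expsumD M M.+1 M) //.
  rewrite -expsumZ; apply: eq_expsum => i; rewrite -expsum_shift.
  by apply: eq_expsum => -[|j]; rewrite ?scale0r // addnS.
have step2 : expsum M.+1 x (fun i => expsum M.+1 y (fun j => i%:R *: C (i + j).-1)) =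
   x *: exp_op c (x + y) v.
  rewrite expsum_exchange (exp_opE _ c0) -(@expsum_widen Nc M) // addrC.
  rewrite -(@expsumD M M.+1 M) //.
  rewrite -expsumZ; apply: eq_expsum => i; rewrite -expsum_shift.
  by apply: eq_expsum => -[|j]; rewrite ?scale0r // addSn addnC.
rewrite scalerBl -!scalerA -step1 -step2 -!expsumZ -expsumB.
apply: eq_expsum => i; rewrite -!expsumZ -!expsumB; apply: eq_expsum => j.
by rewrite abc scalerBl !scalerA.
Qed.

End ExpSum.

Section PsiRelations.
Variable F : fieldType.
Implicit Types (lambda alpha : F) (p q f : {mpoly F[2]}) (h : int -> {poly F}).

Let t := tvar F.
Let s := svar F.

Lemma mpoly2_ind (P : {mpoly F[2]} -> Prop) :
  (forall c, P c%:MP) -> P t -> P s ->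
  (forall p q, P p -> P q -> P (p + q)) ->
  (forall p q, P p -> P q -> P (p * q)) -> forall p, P p.
Proof.
move=> PC Pt Ps PD PM.
have PU (i : 'I_2) : P 'X_i.
  case: i => -[|[|//]] i_lt.
    by have -> : Ordinal i_lt = ord0 by apply: val_inj.
  by have -> : Ordinal i_lt = ord_max by apply: val_inj.
have PX (i : 'I_2) n : P ('X_i ^+ n).
  elim: n => [|n IH]; first by rewrite expr0 -mpolyC1.
  by rewrite exprS; apply: (PM).
elim/mpolyind => [|c m p _ _ Pp]; first by rewrite -mpolyC0.
apply: (PD) => //; rewrite -mul_mpolyC; apply: (PM) => //.
by rewrite mpolyXE_id big_ord_recl big_ord1; apply: PM.
Qed.

Lemma s_shiftD m : {morph @s_shift F m : p q / p + q >-> p + q}.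
Proof. exact: comp_mpolyD. Qed.

Lemma s_shiftM m : {morph @s_shift F m : p q / p * q >-> p * q}.
Proof. by move=> p q; rewrite /s_shift rmorphM. Qed.

Lemma s_shiftC m c : s_shift m (c%:MP : {mpoly F[2]}) = c%:MP.
Proof. exact: comp_mpolyC. Qed.

Lemma s_shift_t m : s_shift m t = t.
Proof. by rewrite /s_shift comp_mpolyXU. Qed.

Lemma s_shift_s m : s_shift m s = s + m%:~R.
Proof. by rewrite /s_shift comp_mpolyXU. Qed.

Lemma s_shift_linear m : linear (@s_shift F m).
Proof. by move=> c p q; rewrite /s_shift linearP. Qed.

Lemma s_shift_int m (n : int) : s_shift m (n%:~R : {mpoly F[2]}) = n%:~R.
Proof. by rewrite -(rmorph_int (@mpolyC 2 F)) s_shiftC. Qed.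

Lemma s_shift_comp m n p : s_shift m (s_shift n p) = s_shift (m + n) p.
Proof.
elim/mpoly2_ind: p => [c|||p q|p q].
- by rewrite !s_shiftC.
- by rewrite !s_shift_t.
- by rewrite !s_shift_s s_shiftD s_shift_s s_shift_int -addrA -intrD; reflexivity.
- by move=> IHp IHq; rewrite !s_shiftD IHp IHq.
- by move=> IHp IHq; rewrite !s_shiftM IHp IHq.
Qed.

Lemma mderiv_t : t^`M(ord0) = 1.
Proof.
rewrite /t /tvar mderivX mnmE eqxx scale1r -mpolyX0; congr 'X_[_].
by apply/mnmP => i; rewrite !mnmE subnn.
Qed.

Lemma mderiv_s : s^`M(ord0) = 0.
Proof. by rewrite /s /svar mderivX mnmE scale0r. Qed.

Lemma mderiv_int m : (m%:~R : {mpoly F[2]})^`M(ord0) = 0.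
Proof. by rewrite -(rmorph_int (@mpolyC 2 F)) mderivC. Qed.

Lemma s_shift_mderiv m p : s_shift m p^`M(ord0) = (s_shift m p)^`M(ord0).
Proof.
elim/mpoly2_ind: p => [c|||p q IHp IHq|p q IHp IHq].
- by rewrite s_shiftC mderivC -mpolyC0 s_shiftC.
- by rewrite s_shift_t mderiv_t -mpolyC1 s_shiftC.
- by rewrite s_shift_s mderivD mderiv_s mderiv_int addr0 -mpolyC0 s_shiftC.
- by rewrite mderivD !s_shiftD IHp IHq mderivD.
- by rewrite mderivM !s_shiftM s_shiftD !s_shiftM IHp IHq mderivM.
Qed.

(* [h(-t)] as an element of [C[t,s]]. *)
Definition minus_t (g : {poly F}) : {mpoly F[2]} :=
  (map_poly (@mpolyC 2 F) g).[- t].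

Lemma minus_tD g k : minus_t (g + k) = minus_t g + minus_t k.
Proof. by rewrite /minus_t rmorphD hornerD. Qed.

Lemma minus_tM g k : minus_t (g * k) = minus_t g * minus_t k.
Proof. by rewrite /minus_t rmorphM hornerM. Qed.

Lemma minus_tC c : minus_t c%:P = c%:MP.
Proof. by rewrite /minus_t map_polyC hornerC. Qed.

Lemma minus_tX : minus_t 'X = - t.
Proof. by rewrite /minus_t map_polyX hornerX. Qed.

Lemma s_shift_minus_t m g : s_shift m (minus_t g) = minus_t g.
Proof.
elim/poly_ind: g => [|g c IH].
  by rewrite -polyC0 minus_tC s_shiftC.
rewrite minus_tD minus_tM minus_tC minus_tX s_shiftD s_shiftM IH s_shiftC.
by rewrite -mulN1r -[X in X * t](rmorphN1 (@mpolyC 2 F)) s_shiftM s_shiftC s_shift_t.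
Qed.

Lemma mderiv_minus_t g : (minus_t g)^`M(ord0) = - minus_t g^`().
Proof.
elim/poly_ind: g => [|g c IH].
  by rewrite deriv0 -polyC0 minus_tC mderivC mpolyC0 oppr0.
rewrite derivD derivM derivX derivC addr0 mulr1.
rewrite !minus_tD !minus_tM minus_tC minus_tX.
rewrite mderivD mderivM IH mderivC mderivN mderiv_t; ring.
Qed.

Lemma hpoly_cocycle (m n : int) k alpha :
  (- m%:~R)%:P * hpoly m k alpha + (n%:~R)%:P * hpoly n k alpha
  - (m%:~R)%:P * ('X - (m%:~R * alpha)%:P) * (hpoly n k alpha)^`()
  + (n%:~R)%:P * ('X - (n%:~R * alpha)%:P) * (hpoly m k alpha)^`()
  = ((n - m)%:~R)%:P * hpoly (m + n) k alpha.
Proof.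
set N := ('X^k - (alpha ^+ k)%:P) %/ ('X - alpha%:P).
have NE : 'X^k = (alpha ^+ k)%:P + N * ('X - alpha%:P).
  rewrite divpK; first by rewrite addrC subrK.
  by rewrite dvdp_XsubCl rootE hornerD hornerN hornerXn hornerC subrr.
rewrite /hpoly -/N NE -!mul_polyC !(derivD, derivN, derivM, derivC, derivX, derivB).
ring.
Qed.

Lemma T_family_cocycle alpha h (m n : int) : T_family alpha h ->
  (- m%:~R)%:P * h m + (n%:~R)%:P * h n
  - (m%:~R)%:P * ('X - (m%:~R * alpha)%:P) * (h n)^`()
  + (n%:~R)%:P * ('X - (n%:~R * alpha)%:P) * (h m)^`()
  = ((n - m)%:~R)%:P * h (m + n).
Proof.
case=> xi /finite_seqP[r xiE] hE.
pose K := (\max_(i <- r) i).+1.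
have xi0 i : (K <= i)%N -> xi i = 0.
  move=> Ki; apply/eqP/negP => /negP xi_i.
  have : [set` r]%classic i by rewrite -xiE.
  move=> /= ir; have := @leq_bigmax_seq _ r xpredT id i ir isT.
  by rewrite leqNgt Ki.
have {}hE k : h k = \sum_(i < K) xi i *: hpoly k i alpha.
  rewrite hE [RHS](fsbig_ord _ _ (fun i => xi i *: hpoly k i alpha)).
  apply/esym/fsbig_widen => // i [_ /=] /negP; rewrite -leqNgt => /xi0 ->.
  by rewrite scale0r.
rewrite !hE; elim: K {xi0 hE} => [|K IH].
  by rewrite !big_ord0 deriv0; ring.
rewrite !big_ord_recr /= !derivD !derivZ.
have := hpoly_cocycle m n K alpha; rewrite -!mul_polyC.
set H := \sum_(i < K) _ in IH *; set H' := \sum_(i < K) _ in IH *.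
set H'' := \sum_(i < K) _ in IH * => hK.
rewrite [RHS]mulrDr -IH [((n - m)%:~R)%:P * (_ * _)]mulrCA -hK; ring.
Qed.

Lemma minus_t_cocycle alpha h (m n : int) : T_family alpha h ->
  - m%:~R * minus_t (h m) + n%:~R * minus_t (h n)
  + m%:~R * (t + m%:~R * alpha%:MP) * minus_t (h n)^`()
  - n%:~R * (t + n%:~R * alpha%:MP) * minus_t (h m)^`()
  = (n%:~R - m%:~R) * minus_t (h (m + n)).
Proof.
move=> /(T_family_cocycle m n)/(congr1 minus_t).
have minus_tN g : minus_t (- g) = - minus_t g.
  by rewrite /minus_t rmorphN hornerN.
rewrite !(minus_tD, minus_tN, minus_tM, minus_tC, minus_tX).
rewrite !(rmorphN, rmorphM, rmorph_int) intrB /= => <-; ring.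
Qed.

Lemma PsiIE lambda m f : PsiI lambda m f = (lambda ^ m)%:MP * s_shift m f.
Proof. by rewrite mul_mpolyC. Qed.

Lemma PsiLE lambda alpha h m f :
  PsiL lambda alpha h m f =
  - ((lambda ^ m)%:MP * ((s - minus_t (h m)) * s_shift m f)) -
  (m%:~R * (lambda ^ m)%:MP) *
     ((t + m%:~R * alpha%:MP) * (s_shift m f)^`M(ord0)).
Proof.
rewrite /PsiL -!mul_mpolyC -/(minus_t (h m)) s_shift_mderiv.
by rewrite !rmorphM /= !rmorph_int.
Qed.

Lemma PsiI_linear lambda m : linear (PsiI lambda m).
Proof.
move=> c p q; rewrite !PsiIE s_shift_linear -!mul_mpolyC; ring.
Qed.

Lemma PsiL_linear lambda alpha h m : linear (PsiL lambda alpha h m).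
Proof.
move=> c p q; rewrite !PsiLE s_shift_linear mderivD mderivZ -!mul_mpolyC; ring.
Qed.

Lemma PsiI_PsiI lambda m n f : lambda != 0 ->
  PsiI lambda m (PsiI lambda n f) = PsiI lambda (m + n) f.
Proof.
move=> l0; rewrite !PsiIE s_shiftM s_shiftC s_shift_comp.
by rewrite mulrA -rmorphM -expfzDr.
Qed.

Lemma s_shiftN m p : s_shift m (- p) = - s_shift m p.
Proof. by rewrite /s_shift rmorphN. Qed.

Let shiftE := (s_shiftD, s_shiftN, s_shiftM, s_shiftC, s_shift_comp,
  s_shift_int, s_shift_s, s_shift_t, s_shift_minus_t, s_shift_mderiv).
Let mderivE := (mderivM, mderivC, mderivD, mderivN, mderiv_t, mderiv_s,
  mderiv_int, mderiv_minus_t).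

Lemma PsiL_PsiI lambda alpha h m n f : lambda != 0 ->
  PsiL lambda alpha h m (PsiI lambda n f) - PsiI lambda n (PsiL lambda alpha h m f)
  = n%:~R *: PsiI lambda (m + n) f.
Proof.
move=> l0; rewrite !(PsiLE, PsiIE) -mul_mpolyC rmorph_int expfzDr // rmorphM /=.
rewrite !shiftE [n + m]addrC.
rewrite !(mderivM, mderivC); ring.
Qed.

Lemma PsiL_PsiL lambda alpha h m n f : lambda != 0 -> T_family alpha h ->
  PsiL lambda alpha h m (PsiL lambda alpha h n f)
  - PsiL lambda alpha h n (PsiL lambda alpha h m f)
  = (n - m)%:~R *: PsiL lambda alpha h (m + n) f.
Proof.
move=> l0 /(minus_t_cocycle m n) co.
rewrite !PsiLE -mul_mpolyC rmorph_int intrB expfzDr // rmorphM /=.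
rewrite !shiftE [n + m]addrC.
rewrite !mderivE.
apply/eqP; rewrite -subr_eq0; apply/eqP.
transitivity ((lambda ^ m)%:MP * (lambda ^ n)%:MP * s_shift (m + n) f *
  (- m%:~R * minus_t (h m) + n%:~R * minus_t (h n)
   + m%:~R * (t + m%:~R * alpha%:MP) * minus_t (h n)^`()
   - n%:~R * (t + n%:~R * alpha%:MP) * minus_t (h m)^`()
   - (n%:~R - m%:~R) * minus_t (h (m + n)))); first by ring.
by rewrite co subrr mulr0.
Qed.

End PsiRelations.

Section HVModule.
Context (F : fieldType) (U : lmodType F).

Lemma HV_module_of_basis (opL opI : int -> {linear U -> U}) :
  (forall m n u, opL m (opL n u) - opL n (opL m u) = (n - m)%:~R *: opL (m + n) u) ->
  (forall m n u, opL m (opI n u) - opI n (opL m u) = n%:~R *: opI (m + n) u) ->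
  (forall m n u, opI m (opI n u) = opI n (opI m u)) ->
  exists sigma : lie_module (HV F) U, forall m u,
    sigma (HVL F m) u = opL m u /\ sigma (HVI F m) u = opI m u.
Proof.
move=> LL LI II.
pose op (a : int + int) u := match a with inl m => opL m u | inr m => opI m u end.
have op_linear a : linear (op a) by case: a => m c u v; exact: linearP.
pose act (x : HV F) u := fglift (op^~ u) x.
have actl u : linear (act^~ u) by exact: fglift_linear.
have act1 a u : act << a >> u = op a u by exact: fglift1.
have act0 u : act 0 u = 0 by exact: linear0.
have actr x : linear (act x).
  move=> c u v; elim/freeg_span_ind: x => [|d k x IH].
    by rewrite !act0 scaler0 addr0.
  rewrite !(actl _ d << k >> x) IH !act1 op_linear !scalerDr !scalerA mulrC.
  by rewrite addrACA.
have act_lie x y u : act (lie x y) u = act x (act y u) - act y (act x u).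
  have act_r0 z : act z 0 = 0 by exact: linear_fun0 (actr z).
  elim/freeg_span_ind: x => [|c a x IH].
    by rewrite [lie _ _]HV_lie0l !act0 act_r0 subrr.
  rewrite lie_linearl !actl actr {}IH.
  suff -> : act (lie (<< a >> : HV F) y) u =
      act << a >> (act y u) - act y (act << a >> u).
    by rewrite opprD addrACA scalerBr.
  elim/freeg_span_ind: y => [|d b y IH].
    by rewrite [lie _ _]HV_lie0r !act0 act_r0 subrr.
  rewrite lie_linearr !actl actr {}IH.
  suff -> : act (lie (<< a >> : HV F) (<< b >> : HV F)) u =
      act << a >> (act << b >> u) - act << b >> (act << a >> u).
    by rewrite opprD addrACA scalerBr.
  have actZ k (z : HV F) w : act (k *: z) w = k *: act z w.
    by rewrite -[k *: z]addr0 actl act0 addr0.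
  have actN (z : HV F) w : act (- z) w = - act z w.
    by have := actZ (-1) z w; rewrite !scaleN1r.
  rewrite [lie _ _]HV_lie_basis !act1.
  case: a b => [m|m] [n|n]; rewrite /= ?actN ?actZ /HVL /HVI ?act1 /=.
  - by rewrite LL.
  - by rewrite LI.
  - by rewrite -LI opprB.
  - by rewrite act0 II subrr.
exists (LieModule actl actr act_lie) => m u /=.
by rewrite /HVL /HVI !act1.
Qed.

End HVModule.

Section HVQRelations.
Context (F : fieldType) (V : lmodType F) (rho : lie_module (HVQ F) V).
Hypothesis F0 : [pchar F] =i pred0.
Hypothesis rho_fin : locally_finite rho.

Lemma lie_HVQL (m n : int) : (-1 <= m)%R -> (-1 <= n)%R ->
  lie (HVQL F m) (HVQL F n) = (n - m)%:~R *: HVQL F (m + n).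
Proof.
move=> m_ge n_ge; apply: val_inj.
have -> : val (lie (HVQL F m) (HVQL F n)) = lie (HVL F m) (HVL F n).
  by rewrite /= -!val_HVQL.
rewrite lie_HVL.
have [mn|mn] := boolP (-1 <= m + n)%R; first by rewrite linearZ /= val_HVQL.
have -> : n - m = 0 by lia.
by rewrite !mulr0z !scale0r.
Qed.

Lemma lie_HVQLI (m n : int) : (-1 <= m)%R -> (0 <= n)%R ->
  lie (HVQL F m) (HVQI F n) = n%:~R *: HVQI F (m + n).
Proof.
move=> m_ge n_ge; apply: val_inj.
have -> : val (lie (HVQL F m) (HVQI F n)) = lie (HVL F m) (HVI F n).
  by rewrite /= -val_HVQL // -val_HVQI.
rewrite lie_HVLI.
have [mn|mn] := boolP (0 <= m + n)%R; first by rewrite linearZ /= val_HVQI.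
have -> : n = 0 by lia.
by rewrite !mulr0z !scale0r.
Qed.

Lemma lie_HVQI (m n : int) : (0 <= m)%R -> (0 <= n)%R ->
  lie (HVQI F m) (HVQI F n) = 0.
Proof.
move=> m_ge n_ge; apply: val_inj.
have -> : val (lie (HVQI F m) (HVQI F n)) = lie (HVI F m) (HVI F n).
  by rewrite /= -!val_HVQI.
exact: lie_HVI.
Qed.

Let coefL i := rho (HVQL F (i%:Z - 1)).
Let coefI i := rho (HVQI F i%:Z).

Lemma finite_int_bounded (A : set int) : finite_set A ->
  exists N, forall i : nat, (N <= i)%N -> ~ A i%:Z.
Proof.
move=> /finite_seqP[r ->]; exists (\max_(j <- r) `|j|%N).+1 => i Ni /= ir.
have := @leq_bigmax_seq _ r xpredT (fun j : int => `|j|%N) _ ir isT.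
by rewrite leqNgt Ni.
Qed.

Lemma coefI_fin : locally_finite_family coefI.
Proof.
move=> v; have [_ /finite_int_bounded[N fN]] := rho_fin v.
exists N => i /fN /= ni; apply: contrapT => nz; apply: ni; split=> //.
Qed.

Lemma coefL_fin : locally_finite_family coefL.
Proof.
move=> v; have [/finite_int_bounded[N fN] _] := rho_fin v.
exists N.+1 => -[//|i] /fN /= ni; apply: contrapT => nz; apply: ni; split=> [|].
  lia.
by move: nz; rewrite /coefL (_ : i.+1%:Z - 1 = i%:Z) //; lia.
Qed.

Let coefL_linear i : linear (coefL i). Proof. exact: lie_act_linearr. Qed.
Let coefI_linear i : linear (coefI i). Proof. exact: lie_act_linearr. Qed.

Let act0 v : rho 0 v = 0.
Proof. exact: linear_fun0 (lie_act_linearl rho v). Qed.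

Let actZ c x v : rho (c *: x) v = c *: rho x v.
Proof.
by have := lie_act_linearl rho v c x 0; rewrite act0 !addr0.
Qed.

Lemma coefLL i j v : coefL i (coefL j v) - coefL j (coefL i v) =
  (1 * j%:R - 1 * i%:R) *: coefL (i + j).-1 v.
Proof.
rewrite /coefL -lie_act_lie lie_HVQL ?actZ; try lia.
have -> : (j%:Z - 1 - (i%:Z - 1))%:~R = 1 * j%:R - 1 * i%:R :> F.
  by rewrite !intrB /=; ring.
case: i j => [|i] [|j]; rewrite ?mul1r ?subrr ?scale0r //;
  congr (_ *: rho (HVQL F _) v); lia.
Qed.

Lemma coefLI i j v : coefL i (coefI j v) - coefI j (coefL i v) =
  (1 * j%:R - 0 * i%:R) *: coefI (i + j).-1 v.
Proof.
rewrite /coefL /coefI -lie_act_lie lie_HVQLI ?actZ; try lia.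
rewrite mul1r mul0r subr0.
case: i j => [|i] [|j]; rewrite ?scale0r //;
  congr (_ *: rho (HVQI F _) v); lia.
Qed.

Lemma coefII i j v : coefI i (coefI j v) - coefI j (coefI i v) =
  (0 * j%:R - 0 * i%:R) *: coefI (i + j).-1 v.
Proof.
by rewrite /coefI -lie_act_lie lie_HVQI // act0 !mul0r subr0 scale0r.
Qed.

Let expL (m : int) : V -> V := exp_op coefL m%:~R.

Let expL0 v : expL 0 v = rho (HVQL F (-1)) v.
Proof. by rewrite /expL exp_op0 //; exact: coefL_fin. Qed.

Let op_expDE m v : op_expD rho m v = expL m v - expL 0 v.
Proof. by rewrite expL0. Qed.

Lemma op_exp_linear m : linear (op_exp rho m).
Proof. exact: exp_op_linear coefI_fin coefI_linear. Qed.

Let expL_linear m : linear (expL m).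
Proof. exact: exp_op_linear coefL_fin coefL_linear. Qed.

Lemma op_expD_linear m : linear (op_expD rho m).
Proof.
move=> c u v; by rewrite !op_expDE !expL_linear scalerBr opprD addrACA.
Qed.

Lemma op_exp_comm m n v :
  op_exp rho m (op_exp rho n v) = op_exp rho n (op_exp rho m v).
Proof.
have := exp_op_comm F0 m%:~R n%:~R v coefI_fin coefI_fin coefI_fin
  coefI_linear coefI_linear coefII.
by rewrite !mul0r subr0 scale0r => /eqP; rewrite subr_eq0 => /eqP.
Qed.

Let expL_op_exp m n v :
  expL m (op_exp rho n v) - op_exp rho n (expL m v) =
  n%:~R *: op_exp rho (m + n) v.
Proof.
have := exp_op_comm F0 m%:~R n%:~R v coefL_fin coefI_fin coefI_fin
  coefL_linear coefI_linear coefLI.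
by rewrite mul0r subr0 mul1r -intrD.
Qed.

Let expL_expL m n v :
  expL m (expL n v) - expL n (expL m v) = (n%:~R - m%:~R) *: expL (m + n) v.
Proof.
have := exp_op_comm F0 m%:~R n%:~R v coefL_fin coefL_fin coefL_fin
  coefL_linear coefL_linear coefLL.
by rewrite !mul1r -intrD.
Qed.

Let linB (f : V -> V) u v : linear f -> f (u - v) = f u - f v.
Proof. by move=> flin; rewrite addrC -scaleN1r flin scaleN1r addrC. Qed.

Lemma op_expD_exp m n v :
  op_expD rho m (op_exp rho n v) - op_exp rho n (op_expD rho m v) =
  n%:~R *: (op_exp rho (m + n) v - op_exp rho n v).
Proof.
have E2 := expL_op_exp 0 n v; rewrite add0r in E2.
rewrite !op_expDE (linB _ _ (op_exp_linear n)) scalerBr -expL_op_exp -E2.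
by rewrite opprD [LHS]addrACA -opprD.
Qed.

Lemma op_expD_expD m n v :
  op_expD rho m (op_expD rho n v) - op_expD rho n (op_expD rho m v) =
  (n%:~R - m%:~R) *: op_expD rho (m + n) v
  + m%:~R *: op_expD rho m v - n%:~R *: op_expD rho n v.
Proof.
have E1 := expL_expL m 0 v; rewrite addr0 mulr0z sub0r in E1.
have E2 := expL_expL 0 n v; rewrite add0r mulr0z subr0 in E2.
have E3 := expL_expL m n v.
have -> : op_expD rho m (op_expD rho n v) - op_expD rho n (op_expD rho m v) =
    (n%:~R - m%:~R) *: expL (m + n) v + m%:~R *: expL m v - n%:~R *: expL n v.
  rewrite !op_expDE !(linB _ _ (expL_linear _)) -E3 -E2.
  rewrite -[m%:~R *: _]opprK -[- (m%:~R *: _)]scaleNr -E1 !opprD !opprK.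
  rewrite (AC ((2*2)*(2*2))%AC ((1*5)*(2*7)*((3*6)*(4*8)))%AC) /= subrr addr0.
  by [].
rewrite !op_expDE !scalerBr; set A := _ *: expL (m + n) v.
rewrite scalerBl !opprB.
rewrite [RHS](AC ((1*2)*2*2)%AC ((1*4*7)*((2*5)*(3*6)))%AC) /=.
by rewrite subrr addNr !addr0.
Qed.

End HVQRelations.

Section TensorModule.
Context (F : fieldType) (V W : lmodType F).

Lemma tensDl v v' (w : W) : tens (v + v' : V) w = tens v w + tens v' w.
Proof. by have := tens_linearl w 1 v v'; rewrite !scale1r. Qed.

Lemma tensBl v v' (w : W) : tens (v - v' : V) w = tens v w - tens v' w.
Proof. by rewrite tensDl -scaleN1r tensZl scaleN1r. Qed.

Lemma tensDr (v : V) (w w' : W) : tens v (w + w') = tens v w + tens v w'.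
Proof. by have := tens_linearr v 1 w w'; rewrite !scale1r. Qed.

Lemma tensZr a (v : V) (w : W) : tens v (a *: w) = a *: tens v w.
Proof.
have t0 : tens v (0 : W) = 0 := linear_fun0 (tens_linearr v).
by have := tens_linearr v a w 0; rewrite addr0 t0 addr0.
Qed.

Lemma tensBr (v : V) (w w' : W) : tens v (w - w') = tens v w - tens v w'.
Proof. by rewrite tensDr -scaleN1r tensZr scaleN1r. Qed.

Lemma tensor_linear_eq (U : lmodType F) (f g : tensor V W -> U) :
  linear f -> linear g -> (forall v w, f (tens v w) = g (tens v w)) -> f =1 g.
Proof.
move=> flin glin fg; elim/tensor_ind => [|v w x IH].
  by rewrite !linear_fun0.
have := flin 1 (tens v w) x; have := glin 1 (tens v w) x.
by rewrite !scale1r fg IH => -> ->.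
Qed.

Lemma tensor_HV_module (D e : int -> V -> V) (l i : int -> W -> W) :
  (forall m, linear (D m)) -> (forall m, linear (e m)) ->
  (forall m, linear (l m)) -> (forall m, linear (i m)) ->
  (forall m n v, e m (e n v) = e n (e m v)) ->
  (forall m n v, D m (e n v) - e n (D m v) = n%:~R *: (e (m + n) v - e n v)) ->
  (forall m n v, D m (D n v) - D n (D m v) =
     (n%:~R - m%:~R) *: D (m + n) v + m%:~R *: D m v - n%:~R *: D n v) ->
  (forall m n w, i m (i n w) = i (m + n) w) ->
  (forall m n w, l m (i n w) - i n (l m w) = n%:~R *: i (m + n) w) ->
  (forall m n w, l m (l n w) - l n (l m w) = (n - m)%:~R *: l (m + n) w) ->
  exists sigma : lie_module (HV F) (tensor V W), forall m v w,
    sigma (HVL F m) (tens v w) = tens v (l m w) + tens (D m v) (i m w) /\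
    sigma (HVI F m) (tens v w) = tens (e m v) (i m w).
Proof.
move=> Dlin elin llin ilin ee De DD ii li ll.
have /choice[opL opLE] : forall m, exists f : {linear tensor V W -> tensor V W},
    forall v w, f (tens v w) = tens v (l m w) + tens (D m v) (i m w).
  move=> m; pose b v w := tens v (l m w) + tens (D m v) (i m w).
  apply: (tensor_lift (b := b)) => [w|v] c x y; rewrite /b.
    by rewrite Dlin !tens_linearl scalerDr addrACA.
  by rewrite llin ilin !tens_linearr scalerDr addrACA.
have /choice[opI opIE] : forall m, exists f : {linear tensor V W -> tensor V W},
    forall v w, f (tens v w) = tens (e m v) (i m w).
  move=> m; pose b v w := tens (e m v) (i m w).
  apply: (tensor_lift (b := b)) => [w|v] c x y; rewrite /b.
    by rewrite elin !tens_linearl.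
  by rewrite ilin !tens_linearr.
have [|||sigma sigmaE] := @HV_module_of_basis _ _ opL opI; last first.
- by exists sigma => m v w; have [-> ->] := sigmaE m (tens v w); rewrite opLE opIE.
- move=> m n; apply: tensor_linear_eq => [c x y|c x y|v w].
  + by rewrite !linearP.
  + by rewrite !linearP.
  by rewrite !opIE !ii ee addrC.
- move=> m n; apply: tensor_linear_eq => [c x y|c x y|v w].
  + by rewrite !linearP addrACA -scalerDr.
  + by rewrite !linearP.
  rewrite !opIE !opLE linearD /= !opIE !ii [n + m]addrC.
  rewrite opprD addrACA -tensBr -tensBl li De tensZr tensZl tensBl scalerBr.
  by rewrite addrC subrK.
- move=> m n; apply: tensor_linear_eq => [c x y|c x y|v w].
  + by rewrite !linearP addrACA -scalerDr.
  + by rewrite !linearP.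
  rewrite !opLE !linearD /= !opLE !ii [n + m]addrC.
  set a := tens v _; set b := tens (D m v) (i m _).
  set c := tens (D n v) (l m _); set d := tens _ (i (m + n) w).
  set a' := tens v _; set b' := tens (D n v) (i n _).
  set c' := tens (D m v) (l n _); set d' := tens (D n _) (i (m + n) w).
  rewrite -opprD.
  have -> : a + b + (c + d) - (a' + b' + (c' + d')) =
      (a - a') + (c - b') - (c' - b) + (d - d').
    rewrite !opprD !opprK.
    by rewrite (AC ((2*2)*(2*2))%AC ((1*5)*(3*6)*(7*2)*(4*8))%AC).
  rewrite /a /a' /b /b' /c /c' /d /d' -!tensBr -tensBl !li ll DD.
  rewrite !tensZr tensBl tensDl !tensZl [n + m]addrC -intrB.
  rewrite (AC (3*3)%AC (1*4*(2*6)*(3*5))%AC) /=.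
  by rewrite subrr addNr !addr0.
Qed.

End TensorModule.

Unset Implicit Arguments.

Theorem proposition5p5 (R : realType) (lambda alpha : R[i])
  (h : int -> {poly R[i]}) (V : lmodType R[i]) (rho : lie_module (HVQ R[i]) V)
  (lambda_neq0 : lambda != 0)
  (hT : T_family alpha h)
  (rho_fin : locally_finite rho) :
  exists sigma : lie_module (HV R[i]) (tensor V {mpoly R[i][2]}),
    forall (m : int) (v : V) (f : {mpoly R[i][2]}),
      sigma (HVL R[i] m) (tens v f)
        = tens v (PsiL lambda alpha h m f)
          + tens (op_expD rho m v) (PsiI lambda m f) /\
      sigma (HVI R[i] m) (tens v f) = tens (op_exp rho m v) (PsiI lambda m f).
Proof.
have F0 : [pchar R[i]] =i pred0 by exact: Num.Theory.pchar_num.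
have [||||||||||sigma sigmaE] := @tensor_HV_module _ V {mpoly R[i][2]}
  (op_expD rho) (op_exp rho) (PsiL lambda alpha h) (PsiI lambda); last first.
- by exists sigma => m v f; exact: sigmaE.
- by move=> m n f; exact: PsiL_PsiL.
- by move=> m n f; exact: PsiL_PsiI.
- by move=> m n f; exact: PsiI_PsiI.
- exact: op_expD_expD.
- exact: op_expD_exp.
- exact: op_exp_comm.
- exact: PsiI_linear.
- exact: PsiL_linear.
- exact: op_exp_linear.
- exact: op_expD_linear.
Qed.
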